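(* Let $X$ be a topological space admitting a complete metric; fix such a complete metric $d$ inducing the topology of $X$. Let $\mathcal{D}$ be an upper semi-continuous decomposition of $X$ with decomposition map $\pi\colon X\to X_{\mathcal{D}}$. Then the following are equivalent: (1) the decomposition map $\pi\colon X\to X_{\mathcal{D}}$ is a near-homeomorphism; (2) $\mathcal{D}$ is shrinkable. If additionally $X$ is locally compact and separable, then shrinkability of $\mathcal{D}$ is also equivalent to (3) for every compact set $C\subset X$, every $\varepsilon>0$ and every $\mathcal{D}$-saturated open cover $\mathcal{U}$ of $X$ there is a homeomorphism $h\colon X\to X$ such that $\operatorname{diam} h(D)<\varepsilon$ for every $D\in\mathcal{D}$ with $D\subset C$, and $h$ is $\mathcal{U}$-close to the identity.
   Context: A decomposition $\mathcal{D}$ of a space $X$ is a set of pairwise disjoint subsets of $X$ whose union is $X$. The decomposition space $X_{\mathcal{D}}$ is the set $\mathcal{D}$ with the quotient topology from the decomposition map $\pi\colon X\to X_{\mathcal{D}}$ sending each point to the element containing it. A neighborhood of a subset is an open set containing it. $\mathcal{D}$ is upper semi-continuous if all its elements are closed and compact and for every $A\in\mathcal{D}$ and every neighborhood $U$ of $A$ there is a neighborhood $V\subset U$ of $A$ such that every $B\in\mathcal{D}$ meeting $V$ satisfies $B\subset U$. An open cover $\mathcal{U}$ of $X$ is $\mathcal{D}$-saturated if each $U\in\mathcal{U}$ is a union of elements of $\mathcal{D}$. A homeomorphism $h\colon X\to X$ is $\mathcal{U}$-close to the identity if for every $x\in X$ there is $U\in\mathcal{U}$ with $x,h(x)\in U$.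 $\mathcal{D}$ is shrinkable if for every open cover $\mathcal{V}$ of $X$ and every $\mathcal{D}$-saturated open cover $\mathcal{U}$ of $X$ there is a homeomorphism $h\colon X\to X$ which is $\mathcal{U}$-close to the identity and such that for every $D\in\mathcal{D}$ the set $h(D)$ is contained in some $V\in\mathcal{V}$. A surjective continuous map $f\colon X\to Y$ is a near-homeomorphism if for every open cover $\mathcal{W}$ of $Y$ there is a homeomorphism $h\colon X\to Y$ such that for every $x\in X$ the points $f(x)$ and $h(x)$ lie in a common $W\in\mathcal{W}$. Diameters are taken with respect to $d$. *)

(* Defs.v *)
From HB Require Import structures.
From mathcomp Require Import all_boot all_order all_algebra generic_quotient.
From mathcomp Require Import all_classical reals ereal topology.

Set Implicit Arguments.
Unset Strict Implicit.
Unset Printing Implicit Defensive.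

Local Open Scope classical_set_scope.
Local Open Scope quotient_scope.
Local Open Scope ring_scope.

Definition homeomorphism (X Y : topologicalType) (h : X -> Y) :=
  continuous h /\
  exists g : Y -> X, [/\ continuous g, cancel h g & cancel g h].

Definition open_cover (X : topologicalType) (U : set (set X)) :=
  (forall A, U A -> open A) /\ cover U id = [set: X].

Definition cover_close (X Y : Type) (W : set (set Y)) (f g : X -> Y) :=
  forall x, exists A, [/\ W A, A (f x) & A (g x)].

Definition near_homeomorphism (X Y : topologicalType) (f : X -> Y) :=
  [/\ continuous f, set_surj [set: X] [set: Y] f &
      forall W : set (set Y), open_cover W ->
        exists2 h : X -> Y, homeomorphism h & cover_close W f h].

(* [partition] also demands that the elements be nonempty; this is what makes
   the decomposition map surjective. *)
Definition decomposition (X : Type) (D : set (set X)) :=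
  partition D id [set: X].

Section decomposition_type.
Context (X : choiceType) (D : set (set X)) (hD : decomposition D).

(* The unused proof argument lets the quotient structure be inferred from the
   type. *)
Definition decomposition_type of decomposition D := set_type D.
Local Notation DT := (decomposition_type hD).

Fact decomposition_class_subproof (x : X) : exists A, A \in D /\ A x.
Proof.
have [cD _ _] := hD; have : cover D id x by rewrite cD.
by move=> [A DA Ax]; exists A; rewrite inE.
Qed.

Definition decomposition_class (x : X) : DT :=
  let: exist A (conj DA _) := cid (decomposition_class_subproof x) in
  exist _ A DA.

Lemma decomposition_classP (x : X) : sval (decomposition_class x) x.
Proof. by rewrite /decomposition_class; case: cid => A []. Qed.

Fact decomposition_repr_subproof (A : DT) : exists x, sval A x.
Proof. by have [_ _ +] := hD; case: A => A /= /set_mem DA; apply. Qed.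

Definition decomposition_repr (A : DT) : X :=
  sval (cid (decomposition_repr_subproof A)).

Lemma decomposition_reprK : cancel decomposition_repr decomposition_class.
Proof.
move=> A; have [_ tD _] := hD; apply/val_inj/tD.
- exact/set_mem/(svalP (decomposition_class _)).
- exact/set_mem/(svalP A).
- exists (decomposition_repr A); split; first exact: decomposition_classP.
  by rewrite /decomposition_repr; case: cid.
Qed.

HB.instance Definition _ := isQuotient.Build X DT decomposition_reprK.
End decomposition_type.

Notation decomposition_space hD := (quotient_topology (decomposition_type hD)).
Notation decomposition_map hD := (\pi_(decomposition_space hD)).

Definition upper_semicontinuous (X : topologicalType) (D : set (set X)) :=
  (forall A, D A -> closed A /\ compact A) /\
  (forall A U, D A -> open U -> A `<=` U ->
     exists V, [/\ open V, A `<=` V, V `<=` U &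
       forall B, D B -> B `&` V !=set0 -> B `<=` U]).

Definition saturated_open_cover (X : topologicalType) (D U : set (set X)) :=
  open_cover U /\
  (forall A, U A -> exists2 E, E `<=` D & A = \bigcup_(B in E) B).

Definition shrinkable (X : topologicalType) (D : set (set X)) :=
  forall V U : set (set X), open_cover V -> saturated_open_cover D U ->
    exists h : X -> X, [/\ homeomorphism h, cover_close U id h &
      forall A, D A -> exists2 B, V B & h @` A `<=` B].

Definition complete_metric (R : realType) (X : metricType R) :=
  forall u : nat -> X, cauchy (u @ \oo) -> exists l : X, u @ \oo --> l.

Definition separable (X : topologicalType) :=
  exists2 S : set X, countable S & dense S.

(* The maximum with 0 gives the empty set diameter 0 instead of -oo. *)
Definition diam (R : realType) (X : metricType R) (A : set X) : \bar R :=
  Order.max 0%E (ereal_sup [set (mdist x y)%:E | x in A & y in A]).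

(* Main.v *)
Require Import Defs.
From mathcomp Require Import all_boot all_order all_algebra generic_quotient.
From mathcomp Require Import all_classical reals ereal topology.
From mathcomp Require Import lra.

(** Everything is done with saturated open sets of [X], which are the preimages
of the open sets of the decomposition space [Y].  Two points are linked by a
cover when they share a member of it, and a chain is a sequence of links.

The topological input is that [Y] is fully normal: every saturated open cover
has a saturated open barycentric refinement ([barycentric_refinement]).  Upper
semi-continuity says that the saturated neighbourhoods [cell n x] satisfy
Frink's metrization axiom ([cell_frink]), and Frink's choice of indices turns
them into a countable sequence of relations that behaves like the balls of
radius [2^-k] of a metric on [Y].

If the decomposition map [pi] is a near-homeomorphism, approximate it by a
homeomorphism [H1], and then by a second one [H2], so closely that the image of
each decomposition element lies in [H1 V] for a single [V] of the given cover.
Then [H1^-1 o H2] shrinks the decomposition, and it is close to the identity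
because [H1] and [H2] are both close to [pi].

Conversely, let [D] be shrinkable and build homeomorphisms
[h_(n+1) = h_n o s_n], where [s_n] is close to the identity with respect to a
saturated cover [U_n], and where [h_(n+1)] makes the decomposition elements
small.  The covers [U_n] are chosen along the way, each one so fine that chains
of [U_(n+1)] lie in members of [U_n], in small neighbourhoods of single
decomposition elements, and in sets with a small [h_(n+1)]-image.  The maps
[pi o h_n^-1] then converge to a homeomorphism [X -> Y] close to [pi]
([limit_homeomorphism]).  Completeness of [X] is used twice.
For fixed [q] the points [h_n^-1 q] stay close to compact sets, so that they
cluster, which produces the limit map; and for fixed [x] the sequence [h_n x] is
Cauchy, which makes this limit map surjective.  Injectivity and continuity of
the inverse come from the smallness of the [h_n]-images.

The limit argument only asks that each decomposition element is eventually made
small.  It therefore applies as soon as the elements contained in the [n]-th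
set of a suitable exhaustion [C] of [X] can be shrunk at stage [n]
([exhaustion_near_homeomorphism]).  For a shrinkable decomposition all sets of
the exhaustion are [X].  In the locally compact separable case they are the
saturations of an exhaustion by compact sets: there the compact form of
shrinkability suffices, since [h_n] is uniformly continuous on a compact
neighbourhood of [C_n].  So that form makes [pi] a near-homeomorphism, and hence
[D] shrinkable. *)

Set Implicit Arguments.
Unset Strict Implicit.
Unset Printing Implicit Defensive.

Import Order.TTheory GRing.Theory Num.Theory.

Local Open Scope classical_set_scope.
Local Open Scope quotient_scope.
Local Open Scope ring_scope.

(** * Thickenings and compactness in a metric space *)

Section metric_facts.
Context {R : realType} {X : metricType R}.
Implicit Types (A G : set X) (x y : X) (e : R).

Lemma nbhs_mdistP x G :
  nbhs x G <-> exists2 e : R, 0 < e & forall y, mdist x y < e -> G y.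
Proof.
rewrite -metricType_numDomainType.filter_from_mdist_nbhs; split.
  by move=> [e e0 H]; exists e.
by move=> [e e0 H]; exists e.
Qed.

Definition thickening A e := [set x | exists2 a, A a & mdist a x < e].

Lemma open_thickening A e : open (thickening A e).
Proof.
rewrite openE => x [a Aa ax]; apply/nbhs_mdistP.
exists (e - mdist a x); first by rewrite subr_gt0.
move=> y xy; exists a => //.
by rewrite (le_lt_trans (metric_triangle a x y))// -ltrBrDl.
Qed.

Lemma sub_thickening A e : 0 < e -> A `<=` thickening A e.
Proof. by move=> e0 x Ax; exists x => //; rewrite mdistxx. Qed.

Lemma compact_thickening A G : compact A -> open G -> A `<=` G ->
  exists2 e : R, 0 < e & thickening A e `<=` G.
Proof.
move=> /compact_near_coveringP cA oG AG.
suff /(cA R 0^'+ (fun e x => forall y, mdist x y < e -> G y)) AF :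
    forall x, A x -> \forall x' \near x & e \near 0^'+,
      forall y, mdist x' y < e -> G y.
  near (0 : R)^'+ => e.
  exists e; first by near: e; exact: nbhs_right_gt.
  move=> y [a Aa ay]; have : A `<=` (fun x => forall y, mdist x y < e -> G y).
    by near: e; exact: (AF (at_right_proper_filter 0)).
  by apply; eassumption.
move=> x Ax; have : nbhs x G by apply: open_nbhs_nbhs; split=> //; exact: AG.
move=> /nbhs_mdistP[r r0 H].
exists ([set z | mdist x z < r / 2], [set e | e < r / 2]) => /=.
  split; first by apply/nbhs_mdistP; exists (r / 2) => //; lra.
  by apply: nbhs_right_lt; lra.
move=> [z e] /= [xz er] y zy; apply: H.
by have := metric_triangle x z y; lra.
Unshelve. all: by end_near. Qed.

Lemma compact_uniform_continuity (h : X -> X) A e : compact A -> continuous h ->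
  0 < e -> exists2 r : R, 0 < r &
    forall x y, A x -> mdist x y < r -> mdist (h x) (h y) < e.
Proof.
move=> /compact_near_coveringP cA ch e0.
suff /(cA R 0^'+ (fun r x => forall y, mdist x y < r -> mdist (h x) (h y) < e))
  AF : forall x, A x -> \forall x' \near x & r \near 0^'+,
      forall y, mdist x' y < r -> mdist (h x') (h y) < e.
  near (0 : R)^'+ => r.
  exists r; first by near: r; exact: nbhs_right_gt.
  move=> x y Ax; have : A `<=`
      (fun x => forall y, mdist x y < r -> mdist (h x) (h y) < e).
    by near: r; exact: (AF (at_right_proper_filter 0)).
  by apply.
move=> x Ax; have /ch/nbhs_mdistP[r r0 H] :
    nbhs (h x) [set z | mdist (h x) z < e / 2].
  by apply/nbhs_mdistP; exists (e / 2) => //; lra.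
exists ([set z | mdist x z < r / 2], [set e | e < r / 2]) => /=.
  split; first by apply/nbhs_mdistP; exists (r / 2) => //; lra.
  by apply: nbhs_right_lt; lra.
move=> [z t] /= [xz er] y zy.
have := metric_triangle x z y => xzy.
have /= xz' := H z ltac:(lra); have /= xy' := H y ltac:(lra).
have := metric_triangle (h z) (h x) (h y).
by rewrite (metric_sym (h z) (h x)) => ?; lra.
Unshelve. all: by end_near. Qed.
End metric_facts.

Section diameter.
Context {R : realType} {X : metricType R}.
Implicit Types (A : set X) (e : R).

Lemma diam_lt A e : (diam A < e%:E)%E ->
  forall x y, A x -> A y -> mdist x y < e.
Proof.
move=> dA x y Ax Ay; rewrite -lte_fin; apply: le_lt_trans dA.
rewrite /diam le_max; apply/orP; right; apply: ereal_sup_ubound.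
by exists x => //; exists y.
Qed.

Lemma diam_le A e : 0 <= e -> (forall x y, A x -> A y -> mdist x y <= e) ->
  (diam A <= e%:E)%E.
Proof.
move=> e0 dA; rewrite /diam ge_max lee_fin e0/=.
by apply: ge_ereal_sup => _ [x Ax [y Ay <-]]; rewrite lee_fin; exact: dA.
Qed.

End diameter.

(** * Saturated sets of an upper semi-continuous decomposition *)

Section decomposition.
Context {R : realType} {X : metricType R} (D : set (set X)).
Hypotheses (hD : decomposition D) (uscD : upper_semicontinuous D).
Implicit Types (A G P : set X) (U W : set (set X)) (x y z a b : X) (e : R).

Definition cls x : set X := sval (decomposition_class hD x).

Lemma cls_in x : D (cls x).
Proof. exact/set_mem/(svalP (decomposition_class hD x)). Qed.

Lemma cls_refl x : cls x x. Proof. exact: decomposition_classP. Qed.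

Lemma clsE A x : D A -> A x -> A = cls x.
Proof.
move=> DA Ax; have [_ tD _] := hD; apply: tD => //; first exact: cls_in.
by exists x; split=> //; exact: cls_refl.
Qed.

Lemma cls_eq x y : cls x y -> cls y = cls x.
Proof. by move=> xy; rewrite -(clsE (cls_in x) xy). Qed.

Lemma cls_sym x y : cls x y -> cls y x.
Proof. by move=> /cls_eq ->; exact: cls_refl. Qed.

Lemma cls_compact x : compact (cls x).
Proof. by have [/(_ _ (cls_in x))[]] := uscD. Qed.

Lemma cls_closed x : closed (cls x).
Proof. by have [/(_ _ (cls_in x))[]] := uscD. Qed.

Definition saturated P := forall x y, P x -> cls x y -> P y.

Lemma saturated_cls x : saturated (cls x).
Proof. by move=> y z xy; rewrite (cls_eq xy). Qed.

(** The largest saturated subset of [G]; upper semi-continuity amounts to the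
openness of the cores of open sets. *)
Definition core G := [set x | cls x `<=` G].

Lemma core_sub G : core G `<=` G.
Proof. by move=> x; apply; exact: cls_refl. Qed.

Lemma saturated_core G : saturated (core G).
Proof. by move=> x y Gx xy; rewrite /core/= (cls_eq xy). Qed.

Lemma sub_core P G : saturated P -> P `<=` G -> P `<=` core G.
Proof. by move=> sP PG x Px y xy; apply: PG; exact: sP xy. Qed.

Lemma coreS G G' : G `<=` G' -> core G `<=` core G'.
Proof. by move=> GG' x Gx y xy; exact/GG'/Gx. Qed.

Lemma open_core G : open G -> open (core G).
Proof.
move=> oG; rewrite openE => x Gx.
have [_ /(_ (cls x) G (cls_in x) oG Gx)[V [oV xV VG H]]] := uscD.
apply: (@filterS _ _ _ V); last first.
  by apply: open_nbhs_nbhs; split=> //; exact/xV/cls_refl.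
move=> y Vy; apply: H; first exact: cls_in.
by exists y; split=> //; exact: cls_refl.
Qed.

(** Upper semi-continuity in metric form: a decomposition element that comes
close to [cls x] at a single point stays close to [cls x] throughout. *)
Lemma cls_modulus x e : 0 < e -> exists2 r : R, 0 < r &
  forall a b, cls a b -> thickening (cls x) r b ->
    cls a `<=` thickening (cls x) e.
Proof.
move=> e0.
have [r r0 rP] : exists2 r : R, 0 < r &
    thickening (cls x) r `<=` core (thickening (cls x) e).
  apply: compact_thickening; first exact: cls_compact.
    exact/open_core/open_thickening.
  by apply: sub_core; [exact: saturated_cls|exact: sub_thickening].
by exists r => // a b /cls_eq <- /rP.
Qed.

Lemma saturated_open_coverP U : saturated_open_cover D U <->
  (forall A, U A -> open A /\ saturated A) /\ (forall x, exists2 A, U A & A x).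
Proof.
split=> [[[oU cU] sU]|[oU cU]].
  split=> [A UA|x].
    split; first exact: oU.
    have [E ED ->] := sU A UA => x y [B EB Bx] xy; exists B => //.
    by rewrite (clsE (ED _ EB) Bx).
  have : cover U id x by rewrite cU.
  by move=> [A UA Ax]; exists A.
split; [split|].
- by move=> A /oU[].
- by apply/seteqP; split=> // x _; have [A UA Ax] := cU x; exists A.
move=> A UA; exists [set cls x | x in A].
  by move=> _ [x _ <-]; exact: cls_in.
apply/seteqP; split=> [x Ax|x [_ [y Ay <-] yx]].
  by exists (cls x); [exists x|exact: cls_refl].
by have [_ /(_ _ _ Ay)] := oU A UA; apply.
Qed.

Definition linked U x y := exists A, [/\ U A, A x & A y].

Lemma linked_refl U x : saturated_open_cover D U -> linked U x x.
Proof. by move=> /saturated_open_coverP[_ /(_ x)[A UA Ax]]; exists A. Qed.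

Lemma linked_sym U x y : linked U x y -> linked U y x.
Proof. by move=> [A [UA Ax Ay]]; exists A. Qed.

Lemma linked_cls U x y y' : saturated_open_cover D U ->
  linked U x y -> cls y y' -> linked U x y'.
Proof.
move=> /saturated_open_coverP[sU _] [A [UA Ax Ay]] yy'; exists A; split=> //.
by have [_] := sU A UA; apply; eassumption.
Qed.

(** Chains have exactly [k] links; since covers link each point to itself,
they can be lengthened at will ([chain_le]). *)
Fixpoint chain U k x y :=
  if k is k'.+1 then exists2 z, linked U x z & chain U k' z y else x = y.

Lemma chain_cat U j k x y z : chain U j x y -> chain U k y z ->
  chain U (j + k) x z.
Proof.
elim: j x => [x -> //|j IH x [w xw wy] yz]; exists w => //; exact: IH.
Qed.

Lemma chain_split U j k x z : chain U (j + k) x z ->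
  exists2 y, chain U j x y & chain U k y z.
Proof.
elim: j x => [x|j IH x [w xw /IH[y wy yz]]]; first by exists x.
by exists y => //; exists w.
Qed.

Lemma chain1 U x y : chain U 1 x y <-> linked U x y.
Proof. by split=> [[z xz <-//]|xy]; exists y. Qed.

Lemma chain_sym U k x y : chain U k x y -> chain U k y x.
Proof.
elim: k x => [x -> //|k IH x [z /linked_sym/chain1 zx /IH]].
by move=> /chain_cat/(_ zx); rewrite addn1.
Qed.

Lemma chain_le U j k x y : saturated_open_cover D U -> (j <= k)%N ->
  chain U j x y -> chain U k x y.
Proof.
move=> sU jk xy; rewrite -(subnKC jk); apply: chain_cat xy _.
by elim: (k - j)%N => // i IH; exists y => //; exact: linked_refl.
Qed.

End decomposition.

(** * Barycentric refinements of saturated covers *)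

Section full_normality.
Context {R : realType} {X : metricType R} (D : set (set X)).
Hypotheses (hD : decomposition D) (uscD : upper_semicontinuous D).
Implicit Types (A G P : set X) (U W : set (set X)) (x y z a : X).
Local Notation cls := (cls hD).
Local Notation core := (core hD).
Local Notation saturated := (saturated hD).

Lemma ex_invSn_lt (n : nat) (e : R) : 0 < e ->
  exists2 m, (n <= m)%N & m.+1%:R^-1 < e.
Proof.
move=> e0; exists (maxn n (Num.truncn e^-1)); first exact: leq_maxl.
rewrite -[ltRHS]invrK ltf_pV2 ?posrE ?invr_gt0//.
apply: (lt_le_trans (truncnS_gt _)).
by rewrite ler_nat ltnS leq_maxr.
Qed.

(** The saturated ball of radius [1/(m+1)] around the decomposition element of
[x]. *)
Definition cell m x := core (thickening (cls x) m.+1%:R^-1).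

Lemma cell_refl m x : cell m x x.
Proof. by apply: sub_thickening; rewrite invr_gt0. Qed.

Lemma open_cell m x : open (cell m x).
Proof. exact/open_core/open_thickening. Qed.

Lemma saturated_cell m x : saturated (cell m x).
Proof. exact: saturated_core. Qed.

Lemma cell_antimono m n x : (m <= n)%N -> cell n x `<=` cell m x.
Proof.
move=> mn; apply: coreS => y [a xa ay]; exists a => //.
by rewrite (lt_le_trans ay)// lef_pV2 ?posrE// ler_nat.
Qed.

Lemma cell_sub x G : open G -> saturated G -> G x -> exists m, cell m x `<=` G.
Proof.
move=> oG sG Gx.
have [e e0 H] : exists2 e : R, 0 < e & thickening (cls x) e `<=` G.
  by apply: compact_thickening => //; [exact: cls_compact|move=> y; exact: sG].
have [m _ me] := ex_invSn_lt 0 e0.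
exists m => y /core_sub [a xa ay]; apply: H; exists a => //.
exact/(lt_trans ay)/me.
Qed.

(** Frink's neighbourhood axiom.  If the cells of [x] and [y] of a large index
[m] meet, then [cls y] has a point close to [cls x], so all of [cls y] is close
to [cls x] by [cls_modulus].  The index [m] depends on [x] only, which gives the
axiom an asymmetry that [frink_cell_sub] exploits. *)
Lemma cell_frink n x : exists2 m, (n < m)%N &
  forall y, cell m x `&` cell m y !=set0 -> cell m y `<=` cell n x.
Proof.
pose e : R := n.+1%:R^-1; have e0 : 0 < e / 2 by rewrite divr_gt0// invr_gt0.
have [r r0 rP] := cls_modulus hD uscD x e0.
have er0 : 0 < Num.min (e / 2) (r / 2) by rewrite lt_min e0 divr_gt0.
have [m nm] := ex_invSn_lt n.+1 er0; rewrite lt_min => /andP[me mr].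
exists m => // y; rewrite /cell; set t : R := m.+1%:R^-1 in me mr *.
move=> [c [/core_sub [a xa ac] /core_sub [b yb bc]]].
have yx : cls y `<=` thickening (cls x) (e / 2).
  apply: rP yb _; exists a => //.
  by have := metric_triangle a c b; rewrite (metric_sym c b); lra.
apply: sub_core; first exact: saturated_cell.
move=> w /core_sub [b' /yx [a' xa' ab'] bw]; exists a' => //.
by have := metric_triangle a' b' w; rewrite -/e; lra.
Qed.

Definition frink_step n x := sval (cid2 (cell_frink n x)).

(** Each point shrinks its cells at its own pace: the index of step [k+1] at [x]
is the one that [cell_frink] assigns to the index of step [k]. *)
Fixpoint frink_index k x : nat :=
  if k is k'.+1 then frink_step (frink_index k' x) x else 0%N.

Definition frink_cell k x := cell (frink_index k x) x.

Definition frink_rel k x y := exists a, frink_cell k a x /\ frink_cell k a y.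

Lemma frink_stepP n x : (n < frink_step n x)%N /\
  forall y, cell (frink_step n x) x `&` cell (frink_step n x) y !=set0 ->
    cell (frink_step n x) y `<=` cell n x.
Proof. by rewrite /frink_step; case: cid2. Qed.

Lemma frink_index_ge k x : (k <= frink_index k x)%N.
Proof.
elim: k => //= k /leq_ltn_trans; apply.
by have [] := frink_stepP (frink_index k x) x.
Qed.

(** Of two intersecting cells of step [k+1], the one whose index is larger lies
in the cell of step [k] around the other centre: enlarge it to the smaller
index, where the choice made at the other centre applies. *)
Lemma frink_cell_sub k x y z : frink_cell k.+1 x z -> frink_cell k.+1 y z ->
  (frink_index k.+1 x <= frink_index k.+1 y)%N ->
  frink_cell k.+1 y `<=` frink_cell k x.
Proof.
move=> xz yz xy; apply: (subset_trans (@cell_antimono _ _ y xy)).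
have [_] := frink_stepP (frink_index k x) x; apply; exists z; split=> //.
exact: cell_antimono yz.
Qed.

Lemma frink_cellS k x : frink_cell k.+1 x `<=` frink_cell k x.
Proof. by apply: (@frink_cell_sub k x x x) => //; exact: cell_refl. Qed.

Lemma frink_rel_refl k x : frink_rel k x x.
Proof. by exists x; split; exact: cell_refl. Qed.

Lemma frink_rel_sym k x y : frink_rel k x y -> frink_rel k y x.
Proof. by move=> [a [ax ay]]; exists a. Qed.

(** By [frink_cell_sub], the union of two intersecting cells of step [k+1] lies
in one cell of step [k]. *)
Lemma frink_rel_trans k x y z :
  frink_rel k.+1 x y -> frink_rel k.+1 y z -> frink_rel k x z.
Proof.
move=> [a [ax ay]] [b [bx bz]].
have [/(frink_cell_sub ay bx) ba|/ltnW/(frink_cell_sub bx ay) ab] :=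
  leqP (frink_index k.+1 a) (frink_index k.+1 b).
  by exists a; split; [exact: frink_cellS|exact: ba].
by exists b; split; [exact: ab|exact: frink_cellS].
Qed.

Lemma frink_rel_le k l x y : (k <= l)%N -> frink_rel l x y -> frink_rel k x y.
Proof.
move=> kl; rewrite -(subnK kl); elim: (l - k)%N => // i IH xy; apply: IH.
by apply: frink_rel_trans xy (frink_rel_refl _ _).
Qed.

Lemma frink_rel_sub x G : open G -> saturated G -> G x ->
  exists k, frink_rel k x `<=` G.
Proof.
move=> oG sG Gx; have [n nG] := cell_sub oG sG Gx.
have [m nm H] := cell_frink n x; exists m => y [a [ax ay]].
apply/nG/(H a); first by exists x; split; [exact: cell_refl|
  exact: (cell_antimono (frink_index_ge m a)) ax].
exact: (cell_antimono (frink_index_ge m a)) ay.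
Qed.

Lemma frink_rel_open k x : open (frink_rel k x) /\ saturated (frink_rel k x).
Proof.
split; last first.
  by move=> y z [a [ax ay]] yz; exists a; split=> //; exact: saturated_cell yz.
rewrite openE => y [a [ax ay]]; apply: (@filterS _ _ _ (frink_cell k a)).
  by move=> z az; exists a.
by apply: open_nbhs_nbhs; split=> //; exact: open_cell.
Qed.

(** The member of [U] is chosen before the members of [W] through [x]: the whole
star of [x] lies in it. *)
Definition barycentric W U := forall x, exists2 A, U A &
  forall B, W B -> B x -> B `<=` A.

(** Refine by the stars [frink_rel (k + 2) x], where [k = deg x] is the least
step at which the star of [x] lies in a member of [U].  Among the centres [x]
whose star contains a given [z], take one of least degree [k]; each point of any
other such star is reached from this [x] within three links of step [k + 2], so
it lies in the star of step [k] around [x]. *)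
Lemma barycentric_refinement U : saturated_open_cover D U ->
  exists2 W, saturated_open_cover D W & barycentric W U.
Proof.
move=> /(saturated_open_coverP hD)[oU cU].
pose good x k := `[< exists2 A, U A & frink_rel k x `<=` A >].
have ex_good x : exists k, good x k.
  have [A UA Ax] := cU x; have [oA sA] := oU A UA.
  by have [k kA] := frink_rel_sub oA sA Ax; exists k; apply/asboolP; exists A.
pose deg x := ex_minn (ex_good x).
exists [set frink_rel (deg x).+2 x | x in [set: X]].
  apply/(saturated_open_coverP hD); split=> [_ [x _ <-]|x].
    exact: frink_rel_open.
  by exists (frink_rel (deg x).+2 x); [exists x|exact: frink_rel_refl].
move=> z.
have exd : exists k, `[< exists2 x, deg x = k & frink_rel (deg x).+2 x z >].
  by exists (deg z); apply/asboolP; exists z => //; exact: frink_rel_refl.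
case: (ex_minnP exd) => k /asboolP[x xk xz] kmin.
have [A UA xA] : exists2 A, U A & frink_rel k x `<=` A.
  by rewrite -xk /deg; case: ex_minnP => n /asboolP.
exists A => // _ [y _ <-] yz w yw; apply: xA.
have ky : (k <= deg y)%N by apply: kmin; apply/asboolP; exists y.
apply: frink_rel_trans (_ : frink_rel k.+1 x z) _.
  by apply: frink_rel_le (leqnSn _) _; rewrite -xk.
apply: frink_rel_trans (frink_rel_le _ (frink_rel_sym yz)) (frink_rel_le _ yw);
  by rewrite !ltnS.
Qed.

End full_normality.

(** * The decomposition space, and near-homeomorphic decompositions *)

Section decomposition_map.
Context {R : realType} {X : metricType R} (D : set (set X)).
Hypotheses (hD : decomposition D).
Local Notation Y := (decomposition_space hD).
Local Notation pi := (\pi_Y : X -> Y).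

Lemma decomposition_mapE x : pi x = decomposition_class hD x.
Proof. by rewrite unlock. Qed.

Lemma cls_map x y : cls hD x y <-> pi x = pi y.
Proof.
rewrite !decomposition_mapE; split=> [xy|xy]; last first.
  by rewrite /cls xy; exact: cls_refl.
have : val (decomposition_class hD x : set_type D) =
    val (decomposition_class hD y : set_type D) by exact/esym/(cls_eq xy).
exact: val_inj.
Qed.

Lemma open_decomposition_space (B : set Y) : open B <-> open (pi @^-1` B).
Proof. by []. Qed.

Lemma saturated_preimage (B : set Y) : saturated hD (pi @^-1` B).
Proof. by move=> x y Bx /cls_map; rewrite /preimage/= => <-. Qed.

Lemma saturated_preimage_image G : saturated hD G -> pi @^-1` (pi @` G) = G.
Proof.
move=> sG; apply/seteqP; split=> [x [y Gy yx]|x Gx]; last by exists x.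
by apply: sG Gy _; exact/cls_map.
Qed.

(** The open cover of the decomposition space that corresponds to a saturated
one. *)
Definition image_cover (U : set (set X)) := [set B : set Y | U (pi @^-1` B)].

Lemma open_image_cover U : saturated_open_cover D U ->
  open_cover (image_cover U).
Proof.
move=> /(saturated_open_coverP hD)[oU cU]; split=> [B /oU[]//|].
apply/seteqP; split=> // y _; have [A UA Ay] := cU (repr y).
have [_ sA] := oU A UA.
exists (pi @` A); first by rewrite /image_cover/= saturated_preimage_image.
by exists (repr y) => //; rewrite reprK.
Qed.

Lemma saturated_preimage_cover (W : set (set Y)) : open_cover W ->
  saturated_open_cover D [set pi @^-1` B | B in W].
Proof.
move=> [oW cW]; apply/(saturated_open_coverP hD); split=> [_ [B WB <-]|x].
  by split; [exact/open_decomposition_space/oW|exact: saturated_preimage].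
have : cover W id (pi x) by rewrite cW.
by move=> [B WB Bx]; exists (pi @^-1` B) => //; exists B.
Qed.

(** Closeness of two maps into the decomposition space, read in [X] on
representatives. *)
Lemma linked_repr U (h : X -> Y) x : cover_close (image_cover U) pi h ->
  linked U x (repr (h x)).
Proof.
by move=> /(_ x)[B [UB Bx Bhx]]; exists (pi @^-1` B); rewrite /preimage/= reprK.
Qed.

End decomposition_map.

Section homeomorphisms.

Lemma homeomorphism_id (X : topologicalType) : homeomorphism (@id X).
Proof.
by split; [move=> x; exact: cvg_id|exists id; split=> // x; exact: cvg_id].
Qed.

Lemma homeomorphism_comp (X Y Z : topologicalType) (f : X -> Y) (g : Y -> Z) :
  homeomorphism f -> homeomorphism g -> homeomorphism (g \o f).
Proof.
move=> [cf [f' [cf' fK f'K]]] [cg [g' [cg' gK g'K]]]; split.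
  by move=> x; apply: continuous_comp; [exact: cf|exact: cg].
exists (f' \o g'); split; [|exact: can_comp|exact: can_comp].
by move=> x; apply: continuous_comp; [exact: cg'|exact: cf'].
Qed.

End homeomorphisms.

Section near_homeomorphism_shrinkable.
Context {R : realType} {X : metricType R} (D : set (set X)).
Hypotheses (hD : decomposition D) (uscD : upper_semicontinuous D).
Local Notation Y := (decomposition_space hD).
Local Notation pi := (\pi_Y : X -> Y).

Lemma near_homeomorphism_shrinkable :
  near_homeomorphism (decomposition_map hD) -> shrinkable D.
Proof.
move=> [_ _ nearH] V U [oV cV] sU.
have [U1 sU1 U1U] := barycentric_refinement hD uscD sU.
have [H1 [cH1 [G1 [cG1 H1K G1K]]] H1U] := nearH _ (open_image_cover hD sU1).
(* links of a barycentric refinement of [N] are links of [U1], and the star of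
   a point is mapped into a single member of [V] by [G1] *)
pose N := [set pi @^-1` (G1 @^-1` A) `&` B | A in V & B in U1].
have sN : saturated_open_cover D N.
  have [oU1 cU1] := (saturated_open_coverP hD _).1 sU1.
  apply/(saturated_open_coverP hD); split=> [_ [A VA [B UB <-]]|x].
    split; last first.
      move=> x y [Ax Bx] xy; split; first exact: saturated_preimage xy.
      by have [_] := oU1 B UB; apply; eassumption.
    apply: openI; last by have [] := oU1 B UB.
    apply/open_decomposition_space.
    by move/continuousP: cG1; apply; exact: oV.
  have : cover V id (G1 (\pi x)) by rewrite cV.
  move=> [A VA Ax]; have [B UB Bx] := cU1 x.
  by exists (pi @^-1` (G1 @^-1` A) `&` B) => //; exists A => //; exists B.
have [U2 sU2 U2N] := barycentric_refinement hD uscD sN.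
have [H2 [cH2 [G2 [cG2 H2K G2K]]] H2U] := nearH _ (open_image_cover hD sU2).
exists (G1 \o H2); split.
- apply: (@homeomorphism_comp _ Y _ H2 G1); split=> //; first by exists G2.
  by exists H1.
- move=> x; pose z := repr (H2 x).
  have [M [U2M Mx Mz]] : linked U2 x z by exact: linked_repr.
  have [_ [A VA [B UB <-]] /(_ M U2M Mz) MB] := U2N z.
  have [M' [U1M' M'x M'z]] : linked U1 (G1 (H2 x)) z.
    have -> : z = repr (H1 (G1 (H2 x))) by rewrite G1K.
    exact: linked_repr.
  have [C UC MC] := U1U z; exists C; split=> //.
    by apply: (MC B) => //; [case: (MB z Mz)|case: (MB x Mx)].
  exact: MC U1M' M'z _ M'x.
- move=> A DA; have [_ _ /(_ A DA)[x Ax]] := hD.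
  have [_ [V0 VV0 [B UB <-]] U2x] := U2N x.
  exists V0 => // _ [y Ay <-] /=.
  have [M [U2M My Mz]] : linked U2 y (repr (H2 y)) by exact: linked_repr.
  have yx : cls hD y x by rewrite -(clsE hD DA Ay).
  have [_ sM] := ((saturated_open_coverP hD _).1 sU2).1 M U2M.
  by have [] := U2x M U2M (sM _ _ My yx) _ Mz; rewrite /preimage/= reprK.
Qed.
End near_homeomorphism_shrinkable.

(** * The limit of a sequence of shrinking homeomorphisms *)

Section cluster_points.
Context {R : realType} {X : metricType R}.
Hypothesis hX : complete_metric X.

(** An ultrafilter containing the tails of [u] contains arbitrarily small balls:
thickenings of compact sets belong to it, and pushing it to the compact set by
a map [p] that moves points very little gives a cluster point around which it
concentrates.  The centres of such balls form a Cauchy sequence. *)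
Lemma complete_cluster_point (u : nat -> X) :
  (forall e : R, 0 < e -> exists2 K : set X, compact K &
    exists N, forall n, (N <= n)%N -> thickening K e (u n)) ->
  exists c, forall (e : R) N, 0 < e ->
    exists2 n, (N <= n)%N & mdist c (u n) < e.
Proof.
move=> tu; have [G [UG uG]] := @ultraFilterLemma _ (u @ \oo) _.
have tail N : G [set u n | n in [set n | (N <= n)%N]].
  by apply: uG; exists N => // n Nn; exists n.
have ball_G (e : R) : 0 < e -> exists c, G [set z | mdist c z < e].
  move=> e0; have e30 : 0 < e / 3 by lra.
  have [K cK [N uK]] := tu _ e30.
  have GK : G (thickening K (e / 3)).
    by apply: filterS (tail N) => _ [n Nn <-]; exact: uK.
  have /choice[p pP] : forall z, exists a, thickening K (e / 3) z ->
      K a /\ mdist a z < e / 3.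
    move=> z; have [[a Ka az]|nz] := pselect (thickening K (e / 3) z).
      by exists a.
    by exists z.
  have [c [Kc cc]] : K `&` cluster (p @ G) !=set0.
    apply: cK; suff : G (p @^-1` K) by [].
    by apply: filterS GK => z /pP[].
  exists c; have [//|nG] := in_ultra_setVsetC [set z | mdist c z < e] UG.
  pose A := p @` (thickening K (e / 3) `&` ~` [set z | mdist c z < e]).
  have := cc A [set z | mdist c z < e / 3].
  case.
  - suff : G (p @^-1` A) by [].
    by apply: filterS (filterI GK nG) => z Gz; exists z.
  - by apply/nbhs_mdistP; exists (e / 3).
  - move=> _ [[z [/pP[_ pz] /= cz] <-] /= cpz]; exfalso; apply: cz.
    by have := metric_triangle c (p z) z; lra.
have /choice[c cP] : forall n, exists c, G [set z | mdist c z < n.+1%:R^-1].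
  by move=> n; apply: ball_G; rewrite invr_gt0.
have [l cl] : exists l : X, c @ \oo --> l.
  apply: hX; apply: (@cauchy_exP _ _ (c @ \oo) _) => e e0.
  have e20 : 0 < e / 2 by lra.
  have [N _ NP] := ex_invSn_lt 0 e20.
  exists (c N); exists N => // n /= Nn; rewrite ballEmdist/=.
  have [z [/= Nz nz]] := filter_ex (filterI (cP N) (cP n)).
  have nN : n.+1%:R^-1 <= N.+1%:R^-1 :> R by rewrite lef_pV2 ?posrE// ler_nat.
  have := metric_triangle (c N) z (c n); rewrite (metric_sym z).
  set s : R := N.+1%:R^-1 in NP Nz nN *; set t : R := n.+1%:R^-1 in nz nN *.
  by lra.
exists l => e N e0; have e20 : 0 < e / 2 by lra.
have [n nP ln] : exists2 n, n.+1%:R^-1 < e / 2 & mdist l (c n) < e / 2.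
  have [M _ MP] := ex_invSn_lt 0 e20.
  have [M' _ M'P] := (metricType_numDomainType.cvgrPdist_lt _ _).1 cl _ e20.
  exists (maxn M M'); last by apply: M'P; rewrite /= leq_maxr.
  by apply: le_lt_trans MP; rewrite lef_pV2 ?posrE// ler_nat ltnS leq_maxl.
have [_ [[k /= Nk <-] /= kn]] := filter_ex (filterI (tail N) (cP n)).
exists k => //; have := metric_triangle l (c n) (u k).
by move: kn nP; set t : R := n.+1%:R^-1 => kn nP; lra.
Qed.

End cluster_points.

Section limit.
Context {R : realType} {X : metricType R} (D : set (set X)).
Hypotheses (hX : complete_metric X).
Hypotheses (hD : decomposition D) (uscD : upper_semicontinuous D).
Local Notation Y := (decomposition_space hD).
Local Notation pi := (\pi_Y : X -> Y).
Local Notation cls := (cls hD).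

Variables (C : nat -> set X) (h g : nat -> X -> X) (U : nat -> set (set X)).
(** Here [g n] is the inverse of [h n]; the sequence of maps to control is
[pi \o g n].  [gU] says that consecutive maps are [U n]-close, [chainU] makes
these closeness conditions summable, [thickU] confines the points [g n q] for
fixed [q], and [smallU] says that [h n.+1] makes small the neighbourhoods of the
decomposition elements in [C n].  Chains of length 4 leave room for the three
links of [inverse_limit_chain] and one more. *)
Hypotheses (evC : forall x, exists N, forall n, (N <= n)%N -> C n x)
  (cg : forall n, continuous (g n))
  (hK : forall n, cancel (h n) (g n)) (gK : forall n, cancel (g n) (h n))
  (sU : forall n, saturated_open_cover D (U n))
  (gU : forall n q, linked (U n) (g n q) (g n.+1 q))
  (chainU : forall n x y, chain (U n.+1) 4 x y -> linked (U n) x y)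
  (thickU : forall n x, exists a,
    chain (U n.+1) 4 x `<=` thickening (cls a) n.+1%:R^-1)
  (smallU : forall n a y z, C n a ->
    chain (U n.+1) 4 a y -> chain (U n.+1) 4 a z ->
    mdist (h n.+1 y) (h n.+1 z) < n.+1%:R^-1).

Let chainW n j k x y : (j <= k)%N -> chain (U n) j x y -> chain (U n) k x y.
Proof. exact: chain_le (sU n). Qed.

Lemma chain_coarsen n k x y : chain (U n.+1) (k * 4) x y -> chain (U n) k x y.
Proof.
elim: k x => // k IH x; rewrite mulSn => /chain_split[z /chainU xz /IH zy].
by exists z.
Qed.

(** A geometric series argument: one link of [U n.+1] followed by the whole
remaining tail, again one link of [U n.+1], is still one link of [U n]. *)
Lemma inverse_tail n k q : linked (U n) (g n.+1 q) (g (n.+1 + k) q).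
Proof.
elim: k n => [|k IH] n; first by rewrite addn0; exact: linked_refl (sU n).
apply: chainU; apply: (@chainW _ 2) => //.
by exists (g n.+2 q) => //; apply/chain1; rewrite addnS -addSn; exact: IH.
Qed.

Lemma inverse_chain n m q : (n <= m)%N -> chain (U n) 2 (g n q) (g m q).
Proof.
rewrite leq_eqVlt => /predU1P[->|nm].
  by apply: (@chainW _ 0).
exists (g n.+1 q) => //; apply/chain1; rewrite -(subnKC nm).
exact: inverse_tail.
Qed.

Lemma inverse_cluster q : exists c, forall (e : R) N, 0 < e ->
  exists2 n, (N <= n)%N & mdist c (g n q) < e.
Proof.
apply: complete_cluster_point => // e e0.
have [n _ ne] := ex_invSn_lt 0 e0.
have [a aP] := thickU n (g n.+1 q).
exists (cls a); first exact: cls_compact.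
exists n.+1 => m nm.
have /aP[b ab bm] : chain (U n.+1) 4 (g n.+1 q) (g m q).
  by apply: chainW (inverse_chain q nm).
by exists b => //; exact: lt_trans ne.
Qed.

Definition inverse_limit q := sval (cid (inverse_cluster q)).
Local Notation phi := inverse_limit.

(** The key estimate: the limit is within three links of [U n] from [g n q],
two to reach a late term of the sequence and one from there to its cluster
point. *)
Lemma inverse_limit_chain n q : chain (U n) 3 (g n q) (phi q).
Proof.
have cP := svalP (cid (inverse_cluster q)).
have [oU /(_ (phi q))[A UA Ac]] := (saturated_open_coverP hD _).1 (sU n).
have /nbhs_mdistP[e e0 eA] : nbhs (phi q) A.
  by apply: open_nbhs_nbhs; split=> //; have [] := oU A UA.
have [m nm cm] := cP e n e0.
apply: (@chainW _ (2 + 1)) => //.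
apply: (chain_cat (inverse_chain q nm)); apply/chain1.
by exists A; split=> //; exact: eA.
Qed.

(** The stars of [x] in the covers [U n] form a neighbourhood basis of [cls x].
Such a star is close to one decomposition element [cls a]; as it contains [x],
[cls a] comes close to [cls x], hence lies close to it by [cls_modulus]. *)
Lemma chain_development x G : open G -> cls x `<=` G ->
  exists n, chain (U n.+1) 4 x `<=` G.
Proof.
move=> oG xG.
have [e e0 eG] := compact_thickening (@cls_compact _ _ _ hD uscD x) oG xG.
have e20 : 0 < e / 2 by lra.
have [r r0 rP] := cls_modulus hD uscD x e20.
have er0 : 0 < Num.min (e / 2) r by rewrite lt_min e20.
have [n _] := ex_invSn_lt 0 er0; rewrite lt_min => /andP[ne nr].
have [a aP] := thickU n x; exists n => y xy.
have [b ab bx] := aP _ (chain_le hD (sU n.+1) (isT : (0 <= 4)%N) (erefl x)).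
have [c ac cy] := aP _ xy.
have [d xd dc] : thickening (cls x) (e / 2) c.
  apply: rP ab _ _ ac; exists x; first exact: cls_refl.
  by rewrite metric_sym; exact: lt_trans nr.
apply: eG; exists d => //; have := metric_triangle d c y.
by move: ne cy; set t : R := n.+1%:R^-1 => ne cy; lra.
Qed.

Lemma chain_separation x y : (forall n, chain (U n) 4 x y) -> cls x y.
Proof.
move=> xy; apply: contrapT => nxy.
have [||n nP] := @chain_development x (~` cls y).
- exact/closed_openC/cls_closed.
- move=> z /cls_eq xz /cls_eq yz; apply: nxy.
  by rewrite -xz yz; exact: cls_refl.
by apply: (nP y (xy n.+1)); exact: cls_refl.
Qed.

Lemma linked_same_cls n x y : cls x y -> linked (U n) x y.
Proof. by apply: linked_cls; [exact: sU|exact: linked_refl (sU n)]. Qed.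

(** If [phi q] and [phi q'] are both linked to [x] in [C n], then [g n.+1 q] and
[g n.+1 q'] are within four links of [x], and [h n.+1] sends them to [q] and
[q'].  This gives both the injectivity of the limit map and the continuity of
its inverse. *)
Lemma inverse_limit_near n x q : C n x -> linked (U n.+1) x (phi q) ->
  forall q', linked (U n.+1) x (phi q') -> mdist q q' < n.+1%:R^-1.
Proof.
move=> Cx xq q' xq'.
rewrite -[q in mdist q](gK n.+1) -[q' in mdist _ q'](gK n.+1).
apply: smallU Cx _ _.
  by exists (phi q) => //; apply/chain_sym/inverse_limit_chain.
by exists (phi q') => //; apply/chain_sym/inverse_limit_chain.
Qed.

Lemma inverse_limit_inj q q' : cls (phi q) (phi q') -> q = q'.
Proof.
move=> qq'; apply: mdist_positivity; apply/eqP/negPn/negP => dq.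
have {}dq : 0 < mdist q q' by rewrite lt_neqAle eq_sym dq mdist_ge0.
have [N NC] := evC (phi q); have [n Nn] := ex_invSn_lt N dq.
rewrite ltNge ltW//; apply: inverse_limit_near (NC n Nn) _ _ _.
  exact/linked_same_cls/cls_refl.
exact: linked_same_cls.
Qed.

(** A preimage of [cls x] is the limit of the points [h m x]: as [g m (h m x)]
is [x], each [g n] with [n <= m] sends [h m x] within two links of [x], so by
[smallU] these points form a Cauchy sequence. *)
Lemma inverse_limit_surj x : exists q, cls x (phi q).
Proof.
have tail n m : (n <= m)%N -> chain (U n) 2 x (g n (h m x)).
  move=> nm; apply: chain_sym; rewrite -[x in chain _ _ _ x](hK m).
  exact: inverse_chain.
have [q hq] : exists q : X, h ^~ x @ \oo --> q.
  apply: hX; apply: (@cauchy_exP _ _ (h ^~ x @ \oo) _) => e e0.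
  have [N NC] := evC x; have [n Nn ne] := ex_invSn_lt N e0.
  exists (h n.+1 x); exists n.+1 => // m /= nm; rewrite ballEmdist/=.
  apply: lt_trans ne; rewrite -(gK n.+1 (h m x)).
  apply: smallU (NC n Nn) _ _; apply: (@chainW _ 2) => //; last exact: tail.
  by rewrite -[X in chain _ _ _ X](hK n.+1); exact: tail.
exists q; apply: chain_separation => n.
apply: (@chainW _ 2) => //; apply: chain_coarsen.
have [oU /(_ (g n.+1 q))[A UA Aq]] := (saturated_open_coverP hD _).1 (sU n.+1).
have /(cg (n := n.+1))/hq[M _ MA] : nbhs (g n.+1 q) A.
  by apply: open_nbhs_nbhs; split=> //; have [] := oU A UA.
pose m := maxn n.+1 M.
apply: (@chainW _ (2 + (1 + 3))) => //.
apply: chain_cat (tail n.+1 m (leq_maxl _ _)) _.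
apply: chain_cat _ (inverse_limit_chain n.+1 q); apply/chain1.
by exists A; split=> //; apply: MA; rewrite /= leq_maxr.
Qed.

(** A uniform limit argument: pass from [phi q] to [g n.+2 q] in three links, to
[g n.+2 q'] in one by continuity of [g n.+2], and to [phi q'] in three. *)
Lemma inverse_limit_continuous : continuous (pi \o phi).
Proof.
apply/continuousP => B /open_decomposition_space oB.
rewrite openE => q Bq.
have [y /cls_map|n nB] := @chain_development (phi q) _ oB.
  by rewrite /preimage/= => <-.
have [oU /(_ (g n.+2 q))[A UA Aq]] := (saturated_open_coverP hD _).1 (sU n.+2).
apply: (@filterS _ _ _ (g n.+2 @^-1` A)); last first.
  by apply: cg; apply: open_nbhs_nbhs; split=> //; have [] := oU A UA.
move=> q' Aq'; apply: nB.
apply: (@chainW _ 2) => //; apply: chain_coarsen.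
apply: (@chainW _ (3 + (1 + 3))) => //.
apply: chain_cat (chain_sym (inverse_limit_chain n.+2 q)) _.
apply: chain_cat _ (inverse_limit_chain n.+2 q'); apply/chain1.
by exists A.
Qed.

Lemma limit_homeomorphism : exists2 f : X -> Y, homeomorphism f &
  forall q, exists2 x, pi x = f q & chain (U 0) 3 (g 0 q) x.
Proof.
exists (pi \o phi); last first.
  by move=> q; exists (phi q) => //; exact: inverse_limit_chain.
split; first exact: inverse_limit_continuous.
have /choice[r rP] : forall y : Y, exists q, pi (phi q) = y.
  move=> y; have [q /cls_map yq] := inverse_limit_surj (repr y).
  by exists q; rewrite -yq reprK.
exists r; split=> [|q|y]; [|exact/inverse_limit_inj/cls_map/rP|exact: rP].
apply/continuousP => B oB; apply/open_decomposition_space.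
rewrite openE => x Bx.
have /nbhs_mdistP[e e0 eB] : nbhs (r (pi x)) B by apply: open_nbhs_nbhs.
have [N NC] := evC x; have [n Nn ne] := ex_invSn_lt N e0.
have [oU /(_ x)[A UA Ax]] := (saturated_open_coverP hD _).1 (sU n.+1).
have [oA sA] := oU A UA.
apply: (@filterS _ _ _ A); last by apply: open_nbhs_nbhs.
have AphiP z : A z -> linked (U n.+1) x (phi (r (pi z))).
  move=> Az; exists A; split=> //; apply: sA Az _; exact/cls_map/esym/rP.
move=> x' Ax'; apply: eB; apply: lt_trans ne.
exact: inverse_limit_near (NC n Nn) (AphiP x Ax) _ (AphiP x' Ax').
Qed.

End limit.

(** * Shrinking along an exhaustion *)

Section shrinking_along_exhaustion.
Context {R : realType} {X : metricType R} (D : set (set X)).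
Hypotheses (hX : complete_metric X).
Hypotheses (hD : decomposition D) (uscD : upper_semicontinuous D).
Local Notation Y := (decomposition_space hD).
Local Notation pi := (\pi_Y : X -> Y).
Local Notation cls := (cls hD).
Local Notation saturated := (saturated hD).

(** Three successive barycentric refinements: the two finer ones each halve the
length of the chain, and the coarsest puts the star of [x] in a single set. *)
Lemma chain_refinement U : saturated_open_cover D U ->
  exists2 W, saturated_open_cover D W &
    forall x, exists2 A, U A & chain W 4 x `<=` A.
Proof.
have chain2 (U' W' : set (set X)) (x y : X) :
    barycentric W' U' -> chain W' 2 x y -> linked U' x y.
  move=> b [z [A [WA Ax Az]] /chain1[B [WB Bz By]]].
  by have [C UC CP] := b z; exists C; split=> //; [exact: (CP A)|exact: (CP B)].
move=> /(barycentric_refinement hD uscD)[U1 sU1 b1].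
have [U2 sU2 b2] := barycentric_refinement hD uscD sU1.
have [U3 sU3 b3] := barycentric_refinement hD uscD sU2.
exists U3 => // x; have [A UA AP] := b1 x; exists A => // y.
move=> /(@chain_split _ _ _ 2 2)[z].
move=> /(chain2 _ _ _ _ b3) xz /(chain2 _ _ _ _ b3) zy.
have [B [U1B Bx By]] : linked U1 x y.
  by apply: chain2 b2 _; exists z => //; exact/chain1.
exact: AP U1B Bx _ By.
Qed.

(** A cover fulfilling the conditions of the limit argument for the next stage.
Near a class in [C], whose [h]-image is small, take a set with a small
[h]-image; near any other class, which avoids the saturated closed set [C], take
a set that avoids [C]. *)
Lemma controlled_refinement U (h : X -> X) (C : set X) (d e : R) :
  saturated_open_cover D U -> continuous h -> closed C -> saturated C ->
  0 < d -> 0 < e ->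
  (forall x y, C x -> cls x y -> mdist (h x) (h y) < e / 3) ->
  exists W, [/\ saturated_open_cover D W,
    forall x y, chain W 4 x y -> linked U x y,
    forall x, exists a, chain W 4 x `<=` thickening (cls a) d &
    forall a y z, C a -> chain W 4 a y -> chain W 4 a z ->
      mdist (h y) (h z) < e].
Proof.
move=> sU ch cC sC d0 e0 he; have [oU cU] := (saturated_open_coverP hD _).1 sU.
pose good := [set P | (open P /\ saturated P) /\ [/\ exists2 A, U A & P `<=` A,
  exists a, P `<=` thickening (cls a) d &
  forall a y z, C a -> P a -> P y -> P z -> mdist (h y) (h z) < e]].
have sgood : saturated_open_cover D good.
  apply/(saturated_open_coverP hD); split=> [P []//|x].
  have [A UA Ax] := cU x; have [oA sA] := oU A UA.
  pose T :=
    if `[< C x >] then h @^-1` thickening (h @` cls x) (e / 3) else ~` C.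
  have oT : open T.
    rewrite /T; case: asboolP => Cx; last exact: closed_openC.
    by move/continuousP: ch; apply; exact: open_thickening.
  have xT : cls x `<=` T.
    rewrite /T; case: asboolP => Cx y xy.
      by apply: sub_thickening; [lra|exists y].
    by move=> /sC /(_ (cls_sym xy)).
  exists (core hD (A `&` (thickening (cls x) d `&` T))); last first.
    move=> y xy; split; first exact: sA Ax xy.
    by split; [exact: sub_thickening|exact: xT].
  split.
    split; last exact: saturated_core.
    by apply: open_core => //; apply: openI => //; apply: openI => //;
      exact: open_thickening.
  split; first by exists A => // y /core_sub[].
    by exists x => y /core_sub[_ []].
  move=> a y z Ca /core_sub[_ [_ Ta]] /core_sub[_ [_ Ty]] /core_sub[_ [_ Tz]].
  move: Ta Ty Tz; rewrite /T; case: asboolP => // Cx _.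
  move=> [_ [b xb <-] yb] [_ [c xc <-] zc].
  have bc : mdist (h b) (h c) < e / 3.
    by apply: he; [exact: sC Cx xb|rewrite (cls_eq xb)].
  have := metric_triangle (h y) (h b) (h z).
  have := metric_triangle (h b) (h c) (h z).
  by rewrite (metric_sym (h y) (h b)); lra.
have [W sW WG] := chain_refinement sgood.
have Wrefl x : chain W 4 x x by apply: (@chain_le _ _ _ hD _ 0).
exists W; split=> // [x y xy|x|a y z Ca ay az].
- have [P [_ [[A UA PA] _ _]] xP] := WG x.
  by exists A; split=> //; [exact/PA/xP/Wrefl|exact/PA/xP].
- have [P [_ [_ [a Pa] _]] xP] := WG x.
  by exists a; apply: subset_trans xP Pa.
- have [P [_ [_ _ Ph]] aP] := WG a.
  exact: Ph Ca (aP _ (Wrefl a)) (aP _ ay) (aP _ az).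
Qed.

Variable (C : nat -> set X).
Hypotheses (cC : forall n, closed (C n)) (sC : forall n, saturated (C n))
  (evC : forall x, exists N, forall n, (N <= n)%N -> C n x)
  (shrinkC : forall n (h : X -> X) (e : R) (U : set (set X)),
    homeomorphism h -> 0 < e -> saturated_open_cover D U ->
    exists s : X -> X, [/\ homeomorphism s, cover_close U id s &
      forall x y, C n x -> cls x y -> mdist (h (s x)) (h (s y)) < e]).

(** The recursion alternates between shrinking with respect to the current cover
and choosing the next cover; the starting cover refines the one prescribed on
the decomposition space, so that the limit is close enough to [pi]. *)
Lemma exhaustion_near_homeomorphism : near_homeomorphism pi.
Proof.
split; first exact: pi_continuous.
  by move=> y _; exists (repr y); rewrite ?reprK.
move=> W oW; have sW := saturated_preimage_cover oW.
have [U0 sU0 U0W] := chain_refinement sW.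
pose good (st : (X -> X) * set (set X)) :=
  homeomorphism st.1 /\ saturated_open_cover D st.2.
pose step n (st st' : (X -> X) * set (set X)) := [/\ good st',
  exists2 s : X -> X, st'.1 = st.1 \o s & cover_close st.2 id s,
  forall x y, chain st'.2 4 x y -> linked st.2 x y,
  forall x, exists a, chain st'.2 4 x `<=` thickening (cls a) n.+1%:R^-1 &
  forall a y z, C n a -> chain st'.2 4 a y -> chain st'.2 4 a z ->
    mdist (st'.1 y) (st'.1 z) < n.+1%:R^-1].
have /choice[F FP] : forall nst, exists st', good nst.2 -> step nst.1 nst.2 st'.
  move=> [n [h U]]; have [[hh sU]|ng] := pselect (good (h, U)); last first.
    by exists (h, U).
  have n0 : 0 < n.+1%:R^-1 :> R by rewrite invr_gt0.
  have n30 : 0 < n.+1%:R^-1 / 3 :> R by rewrite divr_gt0.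
  have [s [hs Us sn]] := shrinkC n hh n30 sU.
  have hhs : homeomorphism (h \o s) by exact: homeomorphism_comp.
  have [U' [sU' *]] :=
    controlled_refinement sU (proj1 hhs) (@cC n) (@sC n) n0 n0 sn.
  by exists (h \o s, U') => _; split=> //; exists s.
pose st := fix st n := if n is n'.+1 then F (n', st n') else (id, U0).
have good_st n : good (st n).
  elim: n => [|n IH] /=; last by case: (FP (n, st n) IH).
  by split=> //; exact: homeomorphism_id.
have stP n : step n (st n) (st n.+1) by exact: FP (n, st n) (good_st n).
have /choice[g gP] : forall n, exists g,
    [/\ continuous g, cancel (st n).1 g & cancel g (st n).1].
  by move=> n; have [[_]] := good_st n.
have cg n : continuous (g n) by case: (gP n).
have hK n : cancel (st n).1 (g n) by case: (gP n).
have gK n : cancel (g n) (st n).1 by case: (gP n).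
have sU n : saturated_open_cover D (st n).2 by case: (good_st n).
have gU n q : linked (st n).2 (g n q) (g n.+1 q).
  have [_ [s stE Us] _ _ _] := stP n; apply: linked_sym.
  have -> : g n q = s (g n.+1 q) by rewrite -[q in LHS](gK n.+1) stE hK.
  exact: Us.
have [f hf fP] := @limit_homeomorphism _ _ D hX hD uscD C (fun n => (st n).1) g
  (fun n => (st n).2) evC cg hK gK sU gU
  (fun n => let: And5 _ _ p _ _ := stP n in p)
  (fun n => let: And5 _ _ _ p _ := stP n in p)
  (fun n => let: And5 _ _ _ _ p := stP n in p).
exists f => // q; have [x <- qx] := fP q.
have [_ [B WB <-] Bq] := U0W q; exists B; split=> //.
  by apply: Bq; apply: (@chain_le _ _ _ hD _ 0).
apply: Bq; apply: (@chain_le _ _ _ hD _ 3) => //.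
by have := gK 0%N q; move: qx => /= + E; rewrite E.
Qed.
End shrinking_along_exhaustion.

(** * Exhaustions by compact sets *)

Section compact_exhaustion.
Context {R : realType} {X : metricType R}.

Lemma compact_sub_increasing (A : set X) (O : nat -> set X) : compact A ->
  (forall n, open (O n)) -> (forall m n, (m <= n)%N -> O m `<=` O n) ->
  A `<=` \bigcup_n O n -> exists n, A `<=` O n.
Proof.
move=> /compact_near_coveringP cA oO mO AO.
suff [n _ nP] : \forall n \near \oo, A `<=` O n.
  by exists n; apply: nP; exact: leqnn.
apply: cA => x /AO[m _ Omx].
exists (O m, [set n | (m <= n)%N]) => /=.
  by split; [exact: open_nbhs_nbhs|exists m].
by move=> [y n] /= [Oy mn]; exact: mO Oy.
Qed.

Lemma closed_mdist_le (x : X) (e : R) : closed [set y | mdist x y <= e].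
Proof.
rewrite (_ : mkset _ = ~` [set y | e < mdist x y]); last first.
  by apply/seteqP; split=> y /=; rewrite leNgt => /negP.
apply: open_closedC; rewrite openE => y /= xy; apply/nbhs_mdistP.
exists (mdist x y - e); first by rewrite subr_gt0.
move=> z yz /=; have := metric_triangle x z y; rewrite (metric_sym z).
by lra.
Qed.

Lemma compact_exhaustion : locally_compact [set: X] -> separable X ->
  exists K : nat -> set X, [/\ forall n, compact (K n),
    forall m n, (m <= n)%N -> K m `<=` K n & forall x, exists n, (K n)° x].
Proof.
move=> lcX [S /countable_injP[i iS] dS].
(* balls around the dense set, indexed by their centre and radius; only the
   compact ones are kept *)
pose B k j :=
  [set z | exists s, [/\ S s, i s = k & mdist s z <= j.+1%:R^-1 :> R]].
pose P k j := if `[< compact (B k j) >] then B k j else set0.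
have cP k j : compact (P k j).
  by rewrite /P; case: asboolP => // _; exact: compact0.
pose K n := \big[setU/set0]_(k < n) \big[setU/set0]_(j < n) P k j.
have KP n x : K n x <-> exists k j, [/\ (k < n)%N, (j < n)%N & P k j x].
  rewrite /K -(bigcup_mkord n (fun k => \big[setU/set0]_(j < n) P k j)).
  split=> [[k /= kn]|[k [j [kn jn Px]]]].
    by rewrite -(bigcup_mkord n (P k)) => -[j /= jn Px]; exists k, j.
  by exists k => //; rewrite -(bigcup_mkord n (P k)); exists j.
exists K; split=> [n|m n mn x|x].
- by do 2 ![apply: bigsetU_compact => ? _].
- move=> /KP[k [j [km jm Px]]]; apply/KP; exists k, j.
  by rewrite !(leq_trans _ mn).
have [M] := lcX x I; move=> /nbhs_mdistP[e e0 /= eM] [cM _].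
have e20 : 0 < e / 2 by lra.
have [j _ je] := ex_invSn_lt 0 e20.
pose r : R := j.+1%:R^-1; have r0 : 0 < r by rewrite invr_gt0.
have [s [[_ -> xs] Ss]] : thickening [set x] r `&` S !=set0.
  apply: dS; last exact: open_thickening.
  by exists x; exact: sub_thickening.
have BE : B (i s) j = [set z | mdist s z <= r].
  apply/seteqP; split=> [z [s' [Ss' ss']]|z sz]; last by exists s.
  by rewrite (iS s' s) ?inE.
have cB : compact (B (i s) j).
  rewrite BE; apply: subclosed_compact cM _; first exact: closed_mdist_le.
  move=> z /= sz; apply: eM => //; have := metric_triangle x s z.
  by rewrite -/r in je; lra.
exists (maxn (i s) j).+1.
apply: (@filterS _ _ _ (thickening [set s] r)); last first.
  apply: open_nbhs_nbhs; split; first exact: open_thickening.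
  by exists s => //; rewrite metric_sym.
move=> z [_ -> sz]; apply/KP; exists (i s), j.
rewrite !ltnS leq_maxl leq_maxr; split=> //.
by rewrite /P; case: asboolP => // _; rewrite BE /=; exact: ltW.
Qed.

End compact_exhaustion.

(** * The shrinking criteria *)

Section shrinking_criteria.
Context {R : realType} {X : metricType R} (D : set (set X)).
Hypotheses (hX : complete_metric X).
Hypotheses (hD : decomposition D) (uscD : upper_semicontinuous D).

(** To make the images under [h \o s] small, shrink the decomposition into the
[h]-preimages of balls. *)
Lemma shrinkable_near_homeomorphism :
  shrinkable D -> near_homeomorphism (decomposition_map hD).
Proof.
move=> shD.
apply: (@exhaustion_near_homeomorphism _ _ _ hX _ uscD (fun=> setT)).
- by move=> _; exact: closedT.
- by [].
- by move=> x; exists 0%N.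
move=> _ h e U hh e0 sU.
pose V := [set h @^-1` thickening [set c] (e / 2) | c in [set: X]].
have [|s [hs Us sV]] := shD V U _ sU.
  split=> [_ [c _ <-]|].
    by move: hh => [/continuousP + _]; apply; exact: open_thickening.
  apply/seteqP; split=> // x _.
  exists (h @^-1` thickening [set h x] (e / 2)); first by exists (h x).
  by apply: sub_thickening => //; lra.
exists s; split=> // x y _ xy.
have [_ [c _ <-] sc] := sV _ (cls_in hD x).
have [_ -> cx] : thickening [set c] (e / 2) (h (s x)).
  by apply: sc; exists x => //; exact: cls_refl.
have [_ -> cy] : thickening [set c] (e / 2) (h (s y)) by apply: sc; exists y.
have := metric_triangle (h (s x)) c (h (s y)).
by rewrite (metric_sym _ c); lra.
Qed.

Definition compactly_shrinkable :=
  forall (C : set X) (eps : R) (U : set (set X)),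
  compact C -> 0 < eps -> saturated_open_cover D U ->
  exists h : X -> X, [/\ homeomorphism h,
    forall A, D A -> A `<=` C -> (diam (h @` A) < eps%:E)%E &
    cover_close U id h].

Lemma shrinkable_compactly_shrinkable : shrinkable D -> compactly_shrinkable.
Proof.
move=> shD C e U _ e0 sU.
pose V := [set thickening [set c] (e / 4) | c in [set: X]].
have [|h [hh Uh hV]] := shD V U _ sU.
  split=> [_ [c _ <-]|]; first exact: open_thickening.
  apply/seteqP; split=> // x _.
  exists (thickening [set x] (e / 4)); first by exists x.
  by apply: sub_thickening => //; lra.
exists h; split=> // A DA _; have [_ [c _ <-] hc] := hV A DA.
apply: (@le_lt_trans _ _ (e / 2)%:E); last by rewrite lte_fin; lra.
apply: diam_le => [|x y /hc[_ -> cx] /hc[_ -> cy]]; first lra.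
by have := metric_triangle x c y; rewrite (metric_sym x c); lra.
Qed.

(** The saturations [C n] of compact sets [K n] are closed, and each lies in
the core of the interior of a larger [K m].  A shrinking map [s] which respects
the saturated cover by this core and the complement of [C n] maps [C n] into
[K m], where the given [h] is uniformly continuous; it is then enough that [s]
makes the classes in [K m] small. *)
Lemma compactly_shrinkable_near_homeomorphism :
  locally_compact [set: X] -> separable X -> compactly_shrinkable ->
  near_homeomorphism (decomposition_map hD).
Proof.
move=> lcX sepX shD; have [K [cK mK KX]] := compact_exhaustion lcX sepX.
pose O n := core hD (K n)°.
have oO n : open (O n) by exact/open_core/open_interior.
have mO m n : (m <= n)%N -> O m `<=` O n.
  by move=> mn; apply: coreS; apply: interiorS; exact: mK.
have OX : \bigcup_n O n = [set: X].
  apply/seteqP; split=> // x _.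
  have [||||n nP] := @compact_sub_increasing _ _ (cls hD x) (fun n => (K n)°).
  - exact: cls_compact.
  - by move=> n; exact: open_interior.
  - by move=> m n mn; apply: interiorS; exact: mK.
  - by move=> y _; have [n] := KX y; exists n.
  by exists n.
(* the complement of this core is the saturation of [K n] *)
pose C n := ~` core hD (~` K n).
have CO n : exists m, C n `<=` O m.
  have [|m mP] := @compact_sub_increasing _ _ (K n) O (cK n) oO mO.
    by rewrite OX.
  exists m => x Cx; have [y [xy Ky]] : exists y, cls hD x y /\ K n y.
    by apply: contra_notP Cx => /forallNP nK y xy Ky; apply: (nK y).
  by apply: saturated_core (mP y Ky) (cls_sym xy).
have cC n : closed (C n).
  apply: open_closedC; apply: open_core => //; apply: closed_openC.
  by apply: compact_closed; [exact: metric_hausdorff|exact: cK].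
have sC n : saturated hD (C n).
  by move=> x y Cx xy Cy; apply: Cx; exact: saturated_core Cy (cls_sym xy).
apply: (@exhaustion_near_homeomorphism _ _ _ hX _ uscD C) => //.
  move=> x; have [N xN] := KX x; exists N => n Nn /core_sub; apply.
  exact: mK Nn _ (interior_subset xN).
move=> n h e U hh e0 sU; have [m nm] := CO n.
have [r r0 rh] := compact_uniform_continuity (cK m) (proj1 hh) e0.
have [oU cU] := (saturated_open_coverP hD _).1 sU.
pose U' := [set A `&` B | A in U & B in [set O m; ~` C n]].
have sU' : saturated_open_cover D U'.
  apply/(saturated_open_coverP hD); split=> [_ [A UA [B OB <-]]|x].
    have [oA sA] := oU A UA.
    have [oB sB] : open B /\ saturated hD B.
      case: OB => ->; first by split; [exact: oO|exact: saturated_core].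
      by split; [exact: closed_openC|rewrite /C setCK; exact: saturated_core].
    split; first exact: openI.
    by move=> x y [Ax Bx] xy; split; [exact: sA Ax xy|exact: sB Bx xy].
  have [A UA Ax] := cU x; have [Cx|nCx] := pselect (C n x).
    exists (A `&` O m); last by split=> //; exact: nm.
    by exists A => //; exists (O m) => //; left.
  exists (A `&` ~` C n); last by split.
  by exists A => //; exists (~` C n) => //; right.
have [s [hs sr U's]] := shD (K m) r U' (cK m) r0 sU'.
exists s; split=> // [x|x y Cx xy].
  by have [_ [[A UA [B _ <-]] [Ax _] [As _]]] := U's x; exists A.
have xK : cls hD x `<=` K m by move=> z /(nm x Cx)/interior_subset.
have sxK : K m (s x).
  have [_ [[A UA [B OB <-]] [_ Bx] [_ Bs]]] := U's x.
  case: OB => BE; rewrite BE in Bx Bs; last by case: Bx.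
  exact: interior_subset (core_sub Bs).
apply: rh => //; apply: (diam_lt (sr _ (cls_in hD x) xK)); last by exists y.
by exists x => //; exact: cls_refl.
Qed.

End shrinking_criteria.

Theorem theorem4p4 (R : realType) (X : metricType R)
    (hX : complete_metric X) (D : set (set X)) (hD : decomposition D)
    (uscD : upper_semicontinuous D) :
  (near_homeomorphism (decomposition_map hD) <-> shrinkable D) /\
  (locally_compact [set: X] -> separable X ->
    (shrinkable D <->
     forall (C : set X) (eps : R) (U : set (set X)),
       compact C -> 0 < eps -> saturated_open_cover D U ->
       exists h : X -> X, [/\ homeomorphism h,
         forall A, D A -> A `<=` C -> (diam (h @` A) < eps%:E)%E &
         cover_close U id h])).
Proof.
have near_shrinkable := near_homeomorphism_shrinkable uscD (hD := hD).
split=> [|lcX sepX].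
  by split=> //; exact: shrinkable_near_homeomorphism.
split; first exact: shrinkable_compactly_shrinkable.
move=> shD; apply: near_shrinkable.
exact: compactly_shrinkable_near_homeomorphism.
Qed.
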